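(* Let $X$ be a finite regular cell complex, $\mathcal F$ a weighted cellular sheaf on $X$, $C$ an upward-closed set of cells of $X$ (if $\sigma\in C$ and $\sigma\trianglelefteq\tau$ then $\tau\in C$), and $Y=X\setminus C$, with inclusion $i:Y\to X$ and restricted (pullback) sheaf $i^*\mathcal F$. Let $\mathcal G$ be the sheaf on $X$ with the same stalks as $\mathcal F$ but with all restriction maps between (distinct) cells not in $C$ set to zero. Put $t=\operatorname{codim}H^k(X;\mathcal G)=\dim C^k(X;\mathcal F)-\dim H^k(X;\mathcal G)$. Then the eigenvalues of $\Delta^k_{\mathcal F}$ are $(t,0)$-interlaced with the eigenvalues of $\Delta^k_{i^*\mathcal F}$, where $\Delta^k_{i^*\mathcal F}$ is padded with zeros to an operator on $C^k(X;\mathcal F)$. Explicitly, if $\lambda_1\le\dots\le\lambda_n$ are the eigenvalues of $\Delta^k_{\mathcal F}$ and $\mu_1\le\dots\le\mu_n$ those of the extension by zero of $\Delta^k_{i^*\mathcal F}$ (with multiplicity, $n=\dim C^k(X;\mathcal F)$), then $\lambda_{j-t}\le\mu_j\le\lambda_j$ for all $j$, where $\lambda_m:=\lambda_1$ for $m<1$.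
   Context: A regular cell complex is identified with its face poset; $\sigma\trianglelefteq\tau$ means that the cell $\sigma$ is contained in the closure of $\tau$. A weighted cellular sheaf $\mathcal F$ on $X$ assigns to each cell $\sigma$ a finite-dimensional inner product space $\mathcal F(\sigma)$ over $\Bbbk=\mathbb R$ or $\mathbb C$ (its stalk) and to each $\sigma\trianglelefteq\tau$ a linear restriction map $\mathcal F_{\sigma\trianglelefteq\tau}:\mathcal F(\sigma)\to\mathcal F(\tau)$ with $\mathcal F_{\sigma\trianglelefteq\sigma}=\mathrm{id}$ and $\mathcal F_{\rho\trianglelefteq\tau}=\mathcal F_{\sigma\trianglelefteq\tau}\circ\mathcal F_{\rho\trianglelefteq\sigma}$ for $\rho\trianglelefteq\sigma\trianglelefteq\tau$. The cochain spaces are the orthogonal direct sums $C^k(X;\mathcal F)=\bigoplus_{\dim\sigma=k}\mathcal F(\sigma)$. Fix a signed incidence relation $[\sigma:\tau]\in\{0,\pm1\}$ coming from orientations of cells: it is nonzero exactly when $\sigma$ is a codimension-one face of $\tau$, and $\sum_\gamma[\sigma:\gamma][\gamma:\tau]=0$ for all $\sigma\trianglelefteq\tau$. The coboundary is $(\delta^kx)_\tau=\sum_{\dim\sigma=k}[\sigma:\tau]\mathcal F_{\sigma\trianglelefteq\tau}(x_\sigma)$, satisfying $\delta^k\delta^{k-1}=0$, and $H^k(X;\mathcal F)=\ker\delta^k/\operatorname{im}\delta^{k-1}$. The Hodge Laplacian is $\Delta^k_{\mathcal F}=(\delta^k)^*\delta^k+\delta^{k-1}(\delta^{k-1})^*$.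 The pullback $i^*\mathcal F$ is the restriction of $\mathcal F$ to the cells of $Y$. Extension by zero is with respect to the orthogonal decomposition $C^k(X;\mathcal F)=C^k(Y;i^*\mathcal F)\oplus\bigoplus_{\sigma\in C,\dim\sigma=k}\mathcal F(\sigma)$. Eigenvalues $\lambda_1\le\dots\le\lambda_n$ of $A$ are $(p,q)$-interlaced with eigenvalues $\mu_1\le\dots\le\mu_n$ of $B$ if $\lambda_{j-p}\le\mu_j\le\lambda_{j+q}$ for all $j$, with $\lambda_m=\lambda_1$ for $m<1$ and $\lambda_m=\lambda_n$ for $m>n$.
   Formalization: The lower bound λ_{j-t} ≤ μ_j is claimed only for j-t ≥ 1, since the convention λ_m:=λ_1 for m<1 makes the claim false (λ=(1,1), μ=(0,0), t=2 on an interval); G need not be a sheaf, and dim H^k(X;G) is read as dim ker δ^k − dim im δ^{k-1} (0 if negative). *)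

(* Defs.v *)
From HB Require Import structures.
From mathcomp Require Import all_boot all_order all_algebra.
From mathcomp Require Import complex.
From mathcomp Require Import all_classical all_reals all_analysis.

Set Implicit Arguments.
Unset Strict Implicit.
Unset Printing Implicit Defensive.
Import Order.TTheory GRing.Theory Num.Theory.
Import numFieldNormedType.Exports.
Local Open Scope classical_set_scope.
Local Open Scope ring_scope.

Variant scalar_kind := RealScalars | ComplexScalars.

Definition scalars (R : realType) (b : scalar_kind) : numFieldType :=
  match b with RealScalars => R | ComplexScalars => R[i] end.

Definition conjugation (R : realType) (b : scalar_kind) :
    involutive_rmorphism (scalars R b) :=
  match b with RealScalars => idfun | ComplexScalars => Num.conj end.

Section DirectSum.
Variables (K : fieldType) (I : finType) (V : I -> vectType K).

Definition dsum : Type := {dffun forall i, V i}.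

HB.instance Definition _ := Choice.on dsum.

Definition dsum_add (x y : dsum) : dsum := [ffun i => x i + y i].
Definition dsum_opp (x : dsum) : dsum := [ffun i => - x i].
Definition dsum_zero : dsum := [ffun i => 0].
Definition dsum_scale (a : K) (x : dsum) : dsum := [ffun i => a *: x i].

Fact dsum_addA : associative dsum_add.
Proof. by move=> x y z; apply/ffunP => i; rewrite !ffunE addrA. Qed.
Fact dsum_addC : commutative dsum_add.
Proof. by move=> x y; apply/ffunP => i; rewrite !ffunE addrC. Qed.
Fact dsum_add0 : left_id dsum_zero dsum_add.
Proof. by move=> x; apply/ffunP => i; rewrite !ffunE add0r. Qed.
Fact dsum_addN : left_inverse dsum_zero dsum_opp dsum_add.
Proof. by move=> x; apply/ffunP => i; rewrite !ffunE addNr. Qed.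

HB.instance Definition _ :=
  GRing.isZmodule.Build dsum dsum_addA dsum_addC dsum_add0 dsum_addN.

Lemma dsumD (x y : dsum) i : (x + y) i = x i + y i.
Proof. by rewrite ffunE. Qed.

Fact dsum_scaleA a b (x : dsum) :
  dsum_scale a (dsum_scale b x) = dsum_scale (a * b) x.
Proof. by apply/ffunP => i; rewrite !ffunE scalerA. Qed.
Fact dsum_scale1 : left_id 1 dsum_scale.
Proof. by move=> x; apply/ffunP => i; rewrite !ffunE scale1r. Qed.
Fact dsum_scaleDr : right_distributive dsum_scale +%R.
Proof. by move=> a x y; apply/ffunP => i; rewrite !ffunE scalerDr. Qed.
Fact dsum_scaleDl (x : dsum) : {morph dsum_scale^~ x : a b / a + b}.
Proof. by move=> a b; apply/ffunP => i; rewrite !ffunE scalerDl. Qed.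

HB.instance Definition _ := GRing.Zmodule_isLmodule.Build K dsum
  dsum_scaleA dsum_scale1 dsum_scaleDr dsum_scaleDl.

Lemma dsumZ a (x : dsum) i : (a *: x) i = a *: x i.
Proof. by rewrite ffunE. Qed.

Import VectorInternalTheory.

Fact dsum_vect_iso :
  Vector.axiom #|{: {i : I & 'I_(dim (V i))}}| dsum.
Proof.
pose J := {i : I & 'I_(dim (V i))}.
pose f (x : dsum) : 'rV[K]_#|{: J}| :=
  \row_j v2r (x (tag (enum_val j : J))) 0 (tagged (enum_val j : J)).
exists f.
  by move=> a x y; apply/rowP => j; rewrite !mxE dsumD dsumZ linearP !mxE.
pose g (r : 'rV[K]_#|{: J}|) : dsum :=
  [ffun i => r2v (\row_(c < dim (V i)) r 0 (enum_rank (Tagged (fun i => 'I_(dim (V i))) c : J)))].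
exists g.
  move=> x; apply/ffunP => i; rewrite ffunE; apply: (canLR v2rK).
  by apply/rowP => c; rewrite !mxE enum_rankK.
move=> r; apply/rowP => j; rewrite mxE ffunE r2vK mxE; congr (r 0 _).
by apply: (canLR enum_valK); case: (enum_val j).
Qed.

HB.instance Definition _ := Lmodule_hasFinDim.Build K dsum dsum_vect_iso.

End DirectSum.

Section RegularCellComplex.
Variable R : realType.

Definition closed_disk (n : nat) : set 'rV[R]_n :=
  [set x | \sum_i x 0 i ^+ 2 <= 1].
Definition open_disk (n : nat) : set 'rV[R]_n :=
  [set x | \sum_i x 0 i ^+ 2 < 1].

Record regular_cell_complex := RegularCellComplex {
  total_space : topologicalType;
  cell : finType;
  cell_set : cell -> set total_space;
  cell_dim : cell -> nat;
  cell_cover : \bigcup_s cell_set s = setT;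
  cell_disjoint : trivIset setT cell_set;
  cell_frontier : forall s t, closure (cell_set t) `&` cell_set s !=set0 ->
    cell_set s `<=` closure (cell_set t);
  (* the closure of a cell is homeomorphic to a closed disk, the cell itself
     corresponding to the open disk *)
  cell_disk : forall s,
    exists (f : 'rV[R]_(cell_dim s) -> total_space)
           (g : total_space -> 'rV[R]_(cell_dim s)),
      [/\ {within @closed_disk _, continuous f},
          {within closure (cell_set s), continuous g},
          forall x, closed_disk x -> g (f x) = x,
          f @` @closed_disk _ = closure (cell_set s) &
          f @` @open_disk _ = cell_set s]
}.

End RegularCellComplex.

(* What cellular cochains need to know of a complex: its cells, their
   dimensions, the face relation and the signs [s : t]. *)
Record cell_data := CellData {
  cells :> finType;
  face : rel cells;
  cdim : cells -> nat;
  incidence : cells -> cells -> int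
}.

Definition face_poset (R : realType) (X : regular_cell_complex R)
    (inc : cell X -> cell X -> int) : cell_data :=
  {| cells := cell X;
     face := fun s t => `[< cell_set s `<=` closure (cell_set t) >];
     cdim := @cell_dim R X;
     incidence := inc |}.

Definition signed_incidence (P : cell_data) : Prop :=
  [/\ forall s t : P, incidence s t \in [:: -1; 0; 1],
      forall s t : P, (incidence s t != 0) = face s t && (cdim t == (cdim s).+1)
    & forall s t : P, face s t -> \sum_r incidence s r * incidence r t = 0].

Definition upward_closed (P : cell_data) (C : {set P}) : Prop :=
  forall s t : P, s \in C -> face s t -> t \in C.

Definition subcomplex (P : cell_data) (A : {set P}) : cell_data :=
  {| cells := {s : P | s \in A};
     face := fun s t => face (val s) (val t);
     cdim := fun s => cdim (val s);
     incidence := fun s t => incidence (val s) (val t) |}.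

Section Adjoint.
Variables (K : numFieldType) (theta : K -> K) (U V : vectType K).
Variables (dU : {dot U for theta}) (dV : {dot V for theta}).

Definition adjoint (f : 'Hom(U, V)) : 'Hom(V, U) :=
  xget 0 [set g : 'Hom(V, U) | forall u v, dV (f u) v = dU u (g v)].

End Adjoint.

Section AdjointTheory.
Variables (K : numFieldType) (theta : involutive_rmorphism K) (U V : vectType K).
Variables (dU : {dot U for theta}) (dV : {dot V for theta}).

Lemma adjointP (f : 'Hom(U, V)) u v : dV (f u) v = dU u (adjoint dU dV f v).
Proof.
suff [g0 g0P] : exists g : 'Hom(V, U), forall u v, dV (f u) v = dU u (g v).
  have := @xgetPex _ 0 [set g : 'Hom(V, U) | forall u v, dV (f u) v = dU u (g v)].
  by move=> /(_ (ex_intro _ g0 g0P)) /=; apply.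
have thK x : theta (theta x) = x by exact: (rmorphK theta).
pose n := \dim {:U}.
pose e := vbasis {:U}.
have eU x : x = \sum_(i < n) coord e i x *: e`_i.
  by apply: coord_vbasis; rewrite memvf.
pose G : 'M[K]_n := \matrix_(i < n, j < n) dU e`_i e`_j.
have Gu : G \in unitmx.
  rewrite -row_free_unit; apply/inj_row_free => r rG.
  pose x : U := \sum_(i < n) r 0 i *: e`_i.
  have xe (j : 'I_n) : dU x e`_j = 0.
    transitivity ((r *m G) 0 j); last by rewrite rG mxE.
    rewrite /x linear_sumlz mxE; apply: eq_bigr => i _.
    by rewrite linearZl_LR mxE.
  have xx : dU x x = 0.
    rewrite {2}/x linear_sumr big1 // => i _.
    by rewrite linearZr_LR /= xe mulr0.
  have x0 : x = 0.
    by apply/eqP; apply: contraT => x0; have := @neq0_dnorm_gt0 _ _ _ dU x x0; rewrite xx ltxx.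
  apply/rowP => j; rewrite [RHS]mxE.
  have /freeP := basis_free (vbasisP {:U}).
  by apply; rewrite -/n -/e; exact: x0.
pose h v : U := \sum_(j < n)
  theta ((invmx G *m \col_(i < n) dV (f e`_i) v) j 0) *: e`_j.
have hl : linear h.
  move=> a x y; rewrite /h scaler_sumr -big_split; apply: eq_bigr => j _ /=.
  rewrite scalerA -scalerDl; congr (_ *: _).
  have -> : \col_(i < n) dV (f e`_i) (a *: x + y) =
      theta a *: (\col_(i < n) dV (f e`_i) x) + \col_(i < n) dV (f e`_i) y.
    by apply/colP => i; rewrite !mxE linearPr.
  by rewrite mulmxDr -scalemxAr !mxE rmorphD rmorphM /= thK.
pose hL : {linear V -> U} := HB.pack h (GRing.isLinear.Build _ _ _ _ h hl).
exists (linfun hL) => x y; rewrite lfunE /= {1 2}[x]eU linear_sum.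
rewrite !linear_sumlz; apply: eq_bigr => i _.
rewrite linearZ !linearZl_LR /=; congr (_ * _).
rewrite /h linear_sumr.
transitivity ((G *m (invmx G *m \col_(i < n) dV (f e`_i) y)) i 0).
  by rewrite mulKVmx // mxE.
rewrite [LHS]mxE; apply: eq_bigr => j _.
by rewrite linearZr_LR /= thK mxE mulrC.
Qed.

End AdjointTheory.

(* Multiplicities are geometric, and the size condition makes f diagonalizable;
   this is harmless since spectrum is only used for self-adjoint f. Over the
   complex numbers x <= y means that y - x is a nonnegative real. *)
Definition spectrum (K : numFieldType) (V : vectType K) (f : 'End(V))
    (lam : seq K) : Prop :=
  [/\ sorted <=%R lam,
      size lam = \dim {:V}
    & forall a, count_mem a lam = \dim (passmx.leigenspace f a)].

Section Sheaves.
Variables (K : numFieldType) (theta : involutive_rmorphism K).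

(* Stalks with their inner products, and a linear map for every pair of cells
   (only those with face s t are ever used); functoriality is the separate
   predicate is_sheaf. *)
Record sheaf_data (P : cell_data) := SheafData {
  stalk : P -> vectType K;
  stalk_dot : forall s, {dot (stalk s) for theta};
  restriction : forall s t, 'Hom(stalk s, stalk t)
}.

Definition is_sheaf (P : cell_data) (F : sheaf_data P) : Prop :=
  (forall s, restriction F s s = \1%VF) /\
  (forall r s t, face r s -> face s t ->
     restriction F r t = (restriction F s t \o restriction F r s)%VF).

Definition pullback (P : cell_data) (A : {set P}) (F : sheaf_data P) :
    sheaf_data (subcomplex A) :=
  @SheafData (subcomplex A)
    (fun s => stalk F (val s))
    (fun s => stalk_dot F (val s))
    (fun s t => restriction F (val s) (val t)).

(* Not functorial in general: for r < s < t with only t in C, the map from r to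
   t survives while the one from r to s is zero. *)
Definition kill_outside (P : cell_data) (C : {set P}) (F : sheaf_data P) :
    sheaf_data P :=
  @SheafData P (stalk F) (stalk_dot F)
    (fun s t => if [&& s != t, s \notin C & t \notin C] then 0
                else restriction F s t).

(* Degrees are integers, so that C^(-1) makes sense; it is zero since no cell
   has negative dimension. *)
Definition cochain (P : cell_data) (F : sheaf_data P) (k : int) : vectType K :=
  dsum (fun s : {s : P | (cdim s)%:Z == k} => stalk F (val s)).

Section Cochains.
Variables (P : cell_data) (F : sheaf_data P).

Section Dot.
Variable k : int.

Definition cochain_dot (x y : cochain F k) : K :=
  \sum_s stalk_dot F (val s) (x s) (y s).

Fact cochain_dot_additivel y : zmod_morphism (cochain_dot^~ y).
Proof.
move=> x z; rewrite /cochain_dot -sumrB; apply: eq_bigr => s _.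
by rewrite !ffunE linearBl.
Qed.
Fact cochain_dot_additiver x : zmod_morphism (cochain_dot x).
Proof.
move=> y z; rewrite /cochain_dot -sumrB; apply: eq_bigr => s _.
by rewrite !ffunE linearBr.
Qed.
Fact cochain_dot_scalablel y : scalable_for *%R (cochain_dot^~ y).
Proof.
move=> a x; rewrite /cochain_dot mulr_sumr; apply: eq_bigr => s _.
by rewrite ffunE linearZl_LR.
Qed.
Fact cochain_dot_scalabler x : scalable_for (theta \; *%R) (cochain_dot x).
Proof.
move=> a y; rewrite /cochain_dot /= mulr_sumr; apply: eq_bigr => s _.
by rewrite ffunE linearZr_LR.
Qed.

HB.instance Definition _ := isBilinear.Build K (cochain F k) (cochain F k) K
  *%R (theta \; *%R) cochain_dot cochain_dot_additivel cochain_dot_additiver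
  cochain_dot_scalablel cochain_dot_scalabler.

Fact cochain_dot_hermitian (x y : cochain F k) :
  cochain_dot x y = (-1) ^+ false * theta (cochain_dot y x).
Proof.
rewrite expr0 mul1r /cochain_dot rmorph_sum; apply: eq_bigr => s _.
by rewrite (@hermitian_subproof _ _ _ _ (stalk_dot F (val s))) expr0 mul1r.
Qed.
Fact cochain_dot_gt0 (x : cochain F k) : x != 0 -> 0 < cochain_dot x x.
Proof.
move=> x0; have [s xs0] : exists s, x s != 0.
  apply/existsP; rewrite -negb_forall; apply: contra x0 => /forallP x0.
  by apply/eqP/ffunP => s; rewrite ffunE; apply/eqP.
have ge0 t : 0 <= stalk_dot F (val t) (x t) (x t).
  have [->|/neq0_dnorm_gt0/ltW//] := eqVneq (x t) 0.
  by rewrite linear0l.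
rewrite /cochain_dot (bigD1 s) //= ltr_pwDl //.
- exact: neq0_dnorm_gt0.
- by apply: sumr_ge0 => t _; exact: ge0.
Qed.

HB.instance Definition _ := isHermitianSesquilinear.Build K (cochain F k)
  false theta cochain_dot cochain_dot_hermitian.
HB.instance Definition _ := isDotProduct.Build K (cochain F k)
  cochain_dot cochain_dot_gt0.

End Dot.

Definition cdot k : {dot (cochain F k) for theta} := @cochain_dot k.

Definition coboundary_fun (j k : int) (x : cochain F j) : cochain F k :=
  [ffun t => \sum_s (incidence (val s) (val t))%:~R *:
               restriction F (val s) (val t) (x s)].

Fact coboundary_linear j k : linear (@coboundary_fun j k).
Proof.
move=> a x y; apply/ffunP => t; rewrite !ffunE scaler_sumr -big_split.
apply: eq_bigr => s _ /=; rewrite !ffunE linearP scalerDr !scalerA.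
by rewrite [_ * a]mulrC.
Qed.

HB.instance Definition _ j k :=
  GRing.isLinear.Build _ _ _ _ _ (@coboundary_linear j k).

(* The coboundary is only meant for k = j + 1; keeping both degrees free avoids
   transporting cochains along k - 1 + 1 = k. *)
Definition coboundary (j k : int) : 'Hom(cochain F j, cochain F k) :=
  linfun (@coboundary_fun j k).

Lemma coboundaryE j k (x : cochain F j) t :
  coboundary j k x t = \sum_s (incidence (val s) (val t))%:~R *:
                         restriction F (val s) (val t) (x s).
Proof. by rewrite lfunE ffunE. Qed.

Definition laplacian (k : int) : 'End(cochain F k) :=
  ((adjoint (cdot k) (cdot (k + 1)) (coboundary k (k + 1))
      \o coboundary k (k + 1))
   + (coboundary (k - 1) k
      \o adjoint (cdot (k - 1)) (cdot k) (coboundary (k - 1) k)))%VF.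

(* dim ker - dim im, i.e. the dimension of ker / im whenever successive
   coboundaries compose to zero; coboundary_comp0 shows this for sheaves. *)
Definition dim_cohomology (k : int) : nat :=
  (\dim (lker (coboundary k (k + 1))) - \dim (limg (coboundary (k - 1) k)))%N.

Lemma coboundary_comp0 (i j k : int) : j = i + 1 -> k = j + 1 ->
  signed_incidence P -> transitive (@face P) -> is_sheaf F ->
  (coboundary j k \o coboundary i j = 0)%VF.
Proof.
move=> ji kj [_ incE inc0] face_trans [_ Fcomp].
apply/lfunP => x; rewrite comp_lfunE zero_lfunE; apply/ffunP => t.
rewrite coboundaryE [RHS]ffunE.
under eq_bigr => s _ do rewrite coboundaryE linear_sum scaler_sumr.
rewrite exchange_big big1 //= => r _.
transitivity ((\sum_s incidence (val r) s * incidence s (val t))%:~R *: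
   restriction F (val r) (val t) (x r)); last first.
  have [rt|rt] := boolP (face (val r) (val t)); first by rewrite inc0 // scale0r.
  rewrite big1 ?scale0r // => s _; apply/eqP; rewrite mulf_eq0.
  apply: contraNT rt; rewrite negb_or !incE => /andP[/andP[rs _] /andP[st _]].
  exact: face_trans rs st.
rewrite rmorph_sum scaler_suml /=.
have ris : (cdim (val r))%:Z = i by exact/eqP/(valP r).
pose G (s : P) := (incidence (val r) s * incidence s (val t))%:~R *:
   restriction F (val r) (val t) (x r).
transitivity (\sum_(s in [pred s : P | (cdim s)%:Z == j]) G s).
  transitivity (\sum_(s : {s : P | (cdim s)%:Z == j}) G (val s)); last first.
    exact/esym/(big_sub [pred s : P | (cdim s)%:Z == j] G).
  apply: eq_bigr => s _; rewrite /G /= linearZ scalerA -intrM.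
  rewrite [_ * incidence _ (val t)]mulrC.
  have [->|] := eqVneq (incidence (val s) (val t) * incidence (val r) (val s)) 0.
    by rewrite !scale0r.
  rewrite mulf_eq0 negb_or !incE => /andP[/andP[st _] /andP[rs _]].
  by rewrite (Fcomp _ _ _ rs st) comp_lfunE.
rewrite big_mkcond; apply: eq_bigr => s _ /=; rewrite inE /G.
case: ifPn => // sj; apply/esym/eqP; rewrite scaler_eq0 intr_eq0; apply/orP; left.
apply: contraNT sj; rewrite mulf_eq0 negb_or !incE.
case/andP => /andP[_ /eqP ds] _.
by apply/eqP; rewrite ds ji intS addrC; congr (_ + 1).
Qed.

End Cochains.

Section Padding.
Variables (P : cell_data) (F : sheaf_data P) (A : {set P}) (k : int).

Local Notation Y := (cochain (pullback A F) k).

Definition restrict_fun (x : cochain F k) : Y :=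
  [ffun s : {s : subcomplex A | (cdim s)%:Z == k} =>
     x (exist (fun s : P => (cdim s)%:Z == k) (val (val s)) (valP s))].

Definition extend_at (y : Y) (s : {s : P | (cdim s)%:Z == k}) :
    stalk F (val s) :=
  match pselect (val s \in A) with
  | left sA => y (exist (fun s : subcomplex A => (cdim s)%:Z == k)
                       (exist _ (val s) sA) (valP s))
  | right _ => 0
  end.

Definition extend_fun (y : Y) : cochain F k := [ffun s => extend_at y s].

Fact restrict_linear : linear restrict_fun.
Proof. by move=> a x y; apply/ffunP => s; rewrite !ffunE. Qed.
Fact extend_linear : linear extend_fun.
Proof.
move=> a x y; apply/ffunP => s; rewrite !ffunE /extend_at.
by case: (pselect (val s \in A)) => sA; rewrite ?ffunE // scaler0 addr0.
Qed.

HB.instance Definition _ := GRing.isLinear.Build _ _ _ _ _ restrict_linear.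
HB.instance Definition _ := GRing.isLinear.Build _ _ _ _ _ extend_linear.

Definition cochain_restrict : 'Hom(cochain F k, Y) := linfun restrict_fun.
Definition cochain_extend : 'Hom(Y, cochain F k) := linfun extend_fun.

Definition pad (f : 'End(Y)) : 'End(cochain F k) :=
  (cochain_extend \o f \o cochain_restrict)%VF.

End Padding.
End Sheaves.

(* lam_(j-p) <= mu_j <= lam_(j+q) for all j; an inequality whose index j - p or
   j + q falls outside the list is void (lam_m is -oo below the list and +oo
   above it). Replacing lam_(j-p) by the least entry of lam when j < p would be
   too strong: the Hodge Laplacian can be the identity of a plane while the one
   of the subcomplex is zero, with p = 2. *)
Definition interlaced (K : numFieldType) (p q : nat) (lam mu : seq K) : Prop :=
  size lam = size mu /\
  forall j, (j < size mu)%N ->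
    ((p <= j)%N -> lam`_(j - p) <= mu`_j) /\
    ((j + q < size lam)%N -> mu`_j <= lam`_(j + q)).

(* Main.v *)
Require Import Defs.
From HB Require Import structures.
From mathcomp Require Import all_boot all_order all_algebra.
From mathcomp Require Import complex zify ring.
From mathcomp Require Import all_classical all_reals all_analysis.

Set Implicit Arguments.
Unset Strict Implicit.
Unset Printing Implicit Defensive.
Import Order.TTheory GRing.Theory Num.Theory.
Local Open Scope ring_scope.

(** Let N(> a) denote the number of eigenvalues larger than a, for a >= 0. If
    f \o g = 0, the part of the Hodge Laplacian f^* f + g g^* with eigenvalues
    > a splits into an f^* f part and a g g^* part, and g g^* has the same
    nonzero eigenvalues as g^* g. Hence N(> a) is the sum of the largest
    dimensions of subspaces S1, S0 on which |f x|^2 > a |x|^2 and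
    |g z|^2 > a |z|^2 respectively, although the two Laplacians need not be
    comparable as quadratic forms because of the g g^* terms.

    The coboundary of F is the sum of that of i^* F, extended by zero, and that
    of G; their images are supported on the cells outside C and in C, so
    |delta_F x|^2 = |delta_Y x|^2 + |delta_G x|^2. Dropping the last term gives
    N_Y(> a) <= N_F(> a); intersecting S1 and S0 with the kernels of delta_G
    gives N_F(> a) <= N_Y(> a) + rank delta_G^k + rank delta_G^(k-1). Since G
    need not be a sheaf, this sum of ranks may exceed n; then t = n and the
    lower bounds are void. *)

(** * Interlacing from counts of the entries above a threshold *)

Lemma sorted_le_nth (K : numFieldType) (s : seq K) i j :
  sorted <=%R s -> (i <= j)%N -> (j < size s)%N -> s`_i <= s`_j.
Proof.
move=> ss ij js; apply: (sorted_leq_nth le_trans le_refl) => //.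
by rewrite inE; apply: leq_ltn_trans js.
Qed.

Definition count_gt (K : numFieldType) (a : K) (s : seq K) : nat :=
  count (fun x : K => a < x) s.

Lemma count_gt_sorted_ub (K : numFieldType) (a : K) (s : seq K) j :
  sorted <=%R s -> (j < size s)%N -> s`_j <= a ->
  (count_gt a s <= size s - j.+1)%N.
Proof.
move=> ss js ja.
rewrite /count_gt -{1}(cat_take_drop j.+1 s) count_cat -size_drop.
rewrite (_ : count _ (take _ _) = 0%N) ?count_size //.
apply/eqP; rewrite -leqn0 leqNgt -has_count; apply/(has_nthP 0); case=> i.
rewrite size_takel // ltnS => ij.
rewrite nth_take // => /(le_lt_trans ja).
by rewrite le_gtF // sorted_le_nth.
Qed.

Lemma count_gt_sorted_lb (K : numFieldType) (a : K) (s : seq K) j :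
  sorted <=%R s -> (j < size s)%N -> a < s`_j ->
  (size s - j <= count_gt a s)%N.
Proof.
move=> ss js ja; rewrite /count_gt -{2}(cat_take_drop j s) count_cat.
rewrite (_ : count _ (drop _ _) = size (drop j s)); last first.
  apply/eqP; rewrite -all_count; apply/(all_nthP 0) => i.
  rewrite size_drop ltn_subRL => ij; rewrite nth_drop.
  by apply: (lt_le_trans ja); rewrite sorted_le_nth // leq_addr.
by rewrite size_drop leq_addl.
Qed.

(** The order of a [numFieldType] is partial; nonnegativity makes the entries comparable. A failing
    inequality is then refuted by taking the smaller of its two sides as threshold. *)
Lemma interlaced_count (K : numFieldType) (t : nat) (lam mu : seq K) :
  sorted <=%R lam -> sorted <=%R mu -> size lam = size mu ->
  {in lam, forall x, 0 <= x} -> {in mu, forall x, 0 <= x} ->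
  (forall a, 0 <= a -> (count_gt a lam <= count_gt a mu + t)%N) ->
  (forall a, 0 <= a -> (count_gt a mu <= count_gt a lam)%N) ->
  interlaced t 0 lam mu.
Proof.
move=> slam smu eqsz lam0 mu0 lam_mu mu_lam; split=> // j jmu.
have l0 i : (i < size lam)%N -> 0 <= lam`_i by move=> ?; rewrite lam0 ?mem_nth.
have m0 i : (i < size mu)%N -> 0 <= mu`_i by move=> ?; rewrite mu0 ?mem_nth.
split=> [tj|]; last rewrite addn0 => jlam.
  have jt : (j - t < size lam)%N by rewrite eqsz (leq_ltn_trans (leq_subr _ _)).
  rewrite real_leNgt ?ger0_real ?l0 ?m0 //; apply/negP => lt_ml.
  have := count_gt_sorted_lb slam jt lt_ml.
  have := count_gt_sorted_ub smu jmu (lexx _).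
  move: (lam_mu _ (m0 _ jmu)); rewrite eqsz; move: jmu tj; lia.
rewrite real_leNgt ?ger0_real ?l0 ?m0 //; apply/negP => lt_lm.
have := count_gt_sorted_lb smu jmu lt_lm.
have := count_gt_sorted_ub slam jlam (lexx _).
move: (mu_lam _ (l0 _ jlam)); rewrite eqsz; move: jmu; lia.
Qed.

(** * Inner products and adjoints *)

Section Dot.
Variables (K : numFieldType) (theta : involutive_rmorphism K) (U : vectType K).
Variable d : {dot U for theta}.

Lemma dotC u v : d u v = theta (d v u).
Proof. by rewrite hermC expr0 mul1r. Qed.

Lemma dot_ge0 u : 0 <= d u u.
Proof.
by have [->|/neq0_dnorm_gt0/ltW//] := eqVneq u 0; rewrite linear0l.
Qed.

Lemma dot_eq0 u : d u u = 0 -> u = 0.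
Proof.
move=> duu; apply/eqP; apply: contraT => u0.
by have := @neq0_dnorm_gt0 _ _ _ d u u0; rewrite duu ltxx.
Qed.

(* Expand 0 <= |a u - v|^2; this replaces Cauchy-Schwarz. *)
Lemma dot_square_gt a u v : 0 <= a -> theta a = a -> d v u = d u v ->
  a * d u u < d u v -> a * d u v < d v v.
Proof.
move=> a0 tha vu ltuv; have := dot_ge0 (a *: u - v).
rewrite linearBl !linearBr /= !linearZl_LR !linearZr_LR /= tha vu.
(* For [a = 0] the expansion gives only a weak inequality; strictness comes from [v] being nonzero,
   as its product with [u] is positive. *)
have [a_eq0|a_neq0] := eqVneq a 0.
  move=> _; move: ltuv; rewrite a_eq0 !mul0r => ltuv; apply: neq0_dnorm_gt0.
  by apply: contraTneq ltuv => ->; rewrite linear0r ltxx.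
have {}a0 : 0 < a by rewrite lt_def a_neq0.
move=> sq_ge0; apply: lt_le_trans (_ : _ < a * d u v *+ 2 - a * (a * d u u)) _.
  by rewrite mulr2n -addrA ltrDl subr_gt0 ltr_pM2l.
rewrite -subr_ge0; apply: le_trans sq_ge0 _; rewrite le_eqVlt; apply/orP; left.
by apply/eqP; rewrite /GRing.scale /=; ring.
Qed.

End Dot.

Section Adjoint.
Variables (K : numFieldType) (theta : involutive_rmorphism K).
Variables (U V : vectType K) (dU : {dot U for theta}) (dV : {dot V for theta}).
Local Notation "f ^*" := (adjoint dU dV f).

Lemma adjointPr (f : 'Hom(U, V)) u v : dU (f^* v) u = dV v (f u).
Proof. by rewrite dotC -adjointP -dotC. Qed.

Lemma adjoint_unique (f : 'Hom(U, V)) (g : 'Hom(V, U)) :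
  (forall u v, dV (f u) v = dU u (g v)) -> f^* = g.
Proof.
move=> fg; apply/lfunP => v; apply/eqP; rewrite -subr_eq0; apply/eqP.
by apply: (dot_eq0 (d := dU)); rewrite linearBr /= -adjointP -fg subrr.
Qed.

End Adjoint.

(** * Sums of eigenspaces of a positive semidefinite operator *)

(** Indexing by [undup s] lists each eigenspace once, so that the sum can be direct. *)
Definition eigen_sum (K : numFieldType) (V : vectType K) (D : 'End(V))
    (s : seq K) (P : pred K) : {vspace V} :=
  (\sum_(i < size (undup s) | P (undup s)`_i)
     passmx.leigenspace D (undup s)`_i)%VS.

Section Eigen.
Variables (K : numFieldType) (theta : involutive_rmorphism K) (V : vectType K).
Variables (d : {dot V for theta}) (D : 'End(V)).
Hypothesis Dsym : forall u v, d (D u) v = d u (D v).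
Hypothesis Dge0 : forall u, 0 <= d (D u) u.

Local Notation E := (passmx.leigenspace D).

Lemma leigenspaceP x a : reflect (D x = a *: x) (x \in E a).
Proof.
rewrite memv_ker add_lfunE opp_lfunE scale_lfunE id_lfunE subr_eq0.
exact: eqP.
Qed.

Lemma eigenvalue_ge0 x a : x \in E a -> x != 0 -> 0 <= a.
Proof.
move=> /leigenspaceP Dx x0; have := Dge0 x.
by rewrite Dx linearZl_LR /= pmulr_lge0 // neq0_dnorm_gt0.
Qed.

Lemma eigen_ortho x y a b : x \in E a -> y \in E b -> a != b -> d x y = 0.
Proof.
move=> xE /[dup] yE /leigenspaceP Dy ab; move/leigenspaceP: (xE) => Dx.
have [->|y0] := eqVneq y 0; first by rewrite linear0r.
(* The second slot of [d] is [theta]-linear, so [b] leaves it as [theta b]; symmetry tested on the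
   pair [y], [y] identifies the two. *)
have thb : theta b = b.
  have := Dsym y y; rewrite Dy linearZl_LR linearZr_LR /=.
  by move/mulIf => <- //; rewrite gt_eqF // neq0_dnorm_gt0.
apply/eqP; have := Dsym x y; rewrite Dx Dy linearZl_LR linearZr_LR /= thb.
by move/eqP; rewrite -subr_eq0 -mulrBl mulf_eq0 subr_eq0 (negbTE ab).
Qed.

Variable s : seq K.
Local Notation e i := (undup s)`_i.
Local Notation W := (eigen_sum D s).

Lemma neq_undup_nth (i j : 'I_(size (undup s))) : i != j -> e i != e j.
Proof. by move=> ij; rewrite nth_uniq ?undup_uniq. Qed.

Lemma eigen_dot_sum (P : pred 'I_(size (undup s))) x y :
  (forall i, P i -> x i \in E (e i)) -> (forall i, P i -> y i \in E (e i)) ->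
  d (\sum_(i | P i) x i) (\sum_(i | P i) y i) = \sum_(i | P i) d (x i) (y i).
Proof.
move=> xE yE; rewrite linear_sumlz; apply: eq_bigr => i Pi.
rewrite linear_sumr (bigD1 i) //= big1 ?addr0 // => j /andP[Pj ji].
by rewrite (eigen_ortho (xE i Pi) (yE j Pj)) // neq_undup_nth // eq_sym.
Qed.

Lemma eigen_sum_direct (P : pred K) :
  directv (\sum_(i < size (undup s) | P (e i)) E (e i)).
Proof.
apply/directv_sum_independent => u uE u0 i Pi.
apply: (dot_eq0 (d := d)).
transitivity (d (u i) 0); last by rewrite linear0r.
rewrite -u0 linear_sumr (bigD1 i) //= big1 ?addr0 // => j /andP[Pj ji].
by apply: (eigen_ortho (uE i Pi) (uE j Pj)); rewrite neq_undup_nth // eq_sym.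
Qed.

Lemma eigen_sum_ortho (P Q : pred K) x y :
  (forall a, P a -> Q a -> False) -> x \in W P -> y \in W Q -> d x y = 0.
Proof.
move=> PQ /memv_sumP[u uE ->] /memv_sumP[v vE ->].
rewrite linear_sumlz big1 // => i Pi; rewrite linear_sumr big1 // => j Qj.
apply: (eigen_ortho (uE i Pi) (vE j Qj)).
by apply/eqP => ij; apply: (PQ (e i)); rewrite // ij.
Qed.

Lemma eigen_sum_stable (P : pred K) (M : 'End(V)) x :
  (forall y, D (M y) = M (D y)) -> x \in W P -> M x \in W P.
Proof.
move=> DM /memv_sumP[u uE ->]; rewrite linear_sum; apply: memv_sumr => i Pi.
by apply/leigenspaceP; rewrite DM (leigenspaceP _ _ (uE i Pi)) linearZ.
Qed.

(** Orthogonality of the eigenspaces diagonalizes both forms of the Rayleigh quotient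
    simultaneously. *)
Lemma eigen_sum_quotient (P : pred K) x : x \in W P ->
  exists2 u, forall i : 'I_(size (undup s)), P (e i) -> u i \in E (e i) &
  [/\ x = \sum_(i < size (undup s) | P (e i)) u i,
      d x x = \sum_(i < size (undup s) | P (e i)) d (u i) (u i) &
      d (D x) x = \sum_(i < size (undup s) | P (e i)) e i * d (u i) (u i)].
Proof.
move=> /memv_sumP[u uE ->]; exists u => //; split; rewrite ?eigen_dot_sum //.
have -> : D (\sum_(i < size (undup s) | P (e i)) u i) =
    \sum_(i < size (undup s) | P (e i)) e i *: u i.
  by rewrite linear_sum; apply: eq_bigr => i Pi; apply/leigenspaceP/uE.
rewrite eigen_dot_sum // => [|i Pi]; last by rewrite memvZ ?uE.
by apply: eq_bigr => i _; rewrite linearZl_LR.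
Qed.

(** The bound on [b] is asked only for [0 <= b] because the negation of [a < b] yields [b <= a] only
    for comparable scalars; eigenvalues of nonzero components are nonnegative. *)
Lemma eigen_sum_quotient_le (P : pred K) a x :
  (forall b, P b -> 0 <= b -> b <= a) -> x \in W P -> d (D x) x <= a * d x x.
Proof.
move=> Pa /eigen_sum_quotient[u uE [_ -> ->]].
rewrite mulr_sumr; apply: ler_sum => i Pi.
have [->|u0] := eqVneq (u i) 0; first by rewrite linear0l !mulr0.
by rewrite ler_wpM2r ?dot_ge0 // Pa // (eigenvalue_ge0 (uE i Pi)).
Qed.

Lemma eigen_sum_quotient_gt (P : pred K) a x :
  (forall b, P b -> a < b) -> x \in W P -> x != 0 -> a * d x x < d (D x) x.
Proof.
move=> Pa /eigen_sum_quotient[u uE [-> -> ->]] x0.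
rewrite mulr_sumr -subr_gt0 -sumrB.
under eq_bigr => i _ do rewrite -mulrBl.
have ge0 (i : 'I_(size (undup s))) : P (e i) -> 0 <= (e i - a) * d (u i) (u i).
  by move=> Pi; rewrite mulr_ge0 ?dot_ge0 // subr_ge0 ltW // Pa.
rewrite lt_neqAle sumr_ge0 // andbT eq_sym; apply: contra x0 => /eqP sum0.
rewrite big1 // => i Pi; apply: (dot_eq0 (d := d)).
have /eqP := psumr_eq0P ge0 sum0 Pi.
by rewrite mulf_eq0 subr_eq0 gt_eqF ?Pa //= => /eqP.
Qed.

Hypothesis sP : spectrum D s.

Lemma dim_eigen_sum (P : pred K) : \dim (W P) = count P s.
Proof.
have [_ _ cnt] := sP; rewrite (directvP (eigen_sum_direct P)) /=.
under eq_bigr => i _ do rewrite -cnt.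
rewrite -(big_mkord (fun i => P (e i)) (fun i => count_mem (e i) s)).
rewrite -(big_nth 0 P (fun x => count_mem x s)) -sum1_count.
(* Grouping [s] by its distinct values writes the count as a sum over [undup s] weighted by
   multiplicities. *)
rewrite -(big_undup_iterop_count _ s P (fun=> 1%N)) /=.
by apply: eq_bigr => x _; rewrite Monoid.iteropE iter_addn_0 mul1n.
Qed.

Lemma spectrum_ge0 : {in s, forall x, 0 <= x}.
Proof.
have [_ _ cnt] := sP => x xs.
have : E x != 0%VS by rewrite -dimv_eq0 -cnt -lt0n -has_count has_pred1.
rewrite -vpick0; exact: eigenvalue_ge0 (memv_pick _).
Qed.

Lemma eigen_sum_capC (P : pred K) : (W P :&: W (predC P) = 0)%VS.
Proof.
apply/eqP; rewrite -subv0; apply/subvP => x; rewrite memv_cap memv0.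
case/andP=> xP xC; apply/eqP/(dot_eq0 (d := d)).
by apply: eigen_sum_ortho xP xC => a /= ->.
Qed.

(** The size condition in [spectrum] enters here: the two disjoint parts have dimensions adding up
    to that of the whole space. *)
Lemma eigen_sum_addC (P : pred K) : (W P + W (predC P) = fullv)%VS.
Proof.
have [_ sz _] := sP; apply/eqP; rewrite eqEdim subvf /=.
by rewrite dimv_disjoint_sum ?eigen_sum_capC // !dim_eigen_sum count_predC sz.
Qed.

End Eigen.

(** * Subspaces on which a map expands *)

(** No adjoint occurs here, so this property passes between maps even when their Laplacians are not
    comparable as forms. *)
Definition expands (K : numFieldType) (theta : K -> K) (U V : vectType K)
    (dU : {dot U for theta}) (dV : {dot V for theta})
    (f : 'Hom(U, V)) (a : K) (S : {vspace U}) : Prop :=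
  forall x, x \in S -> x != 0 -> a * dU x x < dV (f x) (f x).

Section Expands.
Variables (K : numFieldType) (theta : involutive_rmorphism K).
Variables (U V : vectType K) (dU : {dot U for theta}) (dV : {dot V for theta}).

(** On the part of [S] inside the kernel of [h], [f] and [g] have equal norms; rank-nullity for [h]
    on [S] bounds the lost dimension. *)
Lemma expands_restrict (f g h : 'Hom(U, V)) a S :
  (forall x, dV (f x) (f x) = dV (g x) (g x) + dV (h x) (h x)) ->
  expands dU dV f a S ->
  exists2 T, expands dU dV g a T & (\dim S <= \dim T + \dim (limg h))%N.
Proof.
move=> fgh fS; exists (S :&: lker h)%VS.
  move=> x /memv_capP[xS]; rewrite memv_ker => /eqP hx x0.
  by have := fS x xS x0; rewrite fgh hx linear0l addr0.
by rewrite -(limg_ker_dim h S) leq_add2l dimvS // limgS // subvf.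
Qed.

Lemma expands_mono (f g h : 'Hom(U, V)) a S :
  (forall x, dV (f x) (f x) = dV (g x) (g x) + dV (h x) (h x)) ->
  expands dU dV g a S -> expands dU dV f a S.
Proof.
move=> fgh gS x xS x0; rewrite fgh; apply: lt_le_trans (gS x xS x0) _.
by rewrite lerDl dot_ge0.
Qed.

End Expands.

(** * Eigenvalue counts of a Hodge Laplacian *)

Section Hodge.
Variables (K : numFieldType) (theta : involutive_rmorphism K).
Variables (V0 V1 V2 : vectType K) (d0 : {dot V0 for theta}).
Variables (d1 : {dot V1 for theta}) (d2 : {dot V2 for theta}).
Variables (f : 'Hom(V1, V2)) (g : 'Hom(V0, V1)).
Hypothesis fg0 : (f \o g = 0)%VF.
Local Notation fs := (adjoint d1 d2 f).
Local Notation gs := (adjoint d0 d1 g).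
Local Notation M := (fs \o f)%VF.
Local Notation N := (g \o gs)%VF.
Local Notation D := (M + N)%VF.

Let fg z : f (g z) = 0.
Proof. by rewrite -comp_lfunE fg0 zero_lfunE. Qed.

Let gf y : gs (fs y) = 0.
Proof.
by apply: (dot_eq0 (d := d0)); rewrite -adjointP -adjointP fg linear0l.
Qed.

Let DE x : D x = fs (f x) + g (gs x).
Proof. by rewrite add_lfunE !comp_lfunE. Qed.

Lemma hodge_dot u v : d1 (D u) v = d2 (f u) (f v) + d0 (gs u) (gs v).
Proof. by rewrite DE linearDl /= adjointPr -adjointP. Qed.

Lemma hodge_sym u v : d1 (D u) v = d1 u (D v).
Proof.
by rewrite hodge_dot DE linearDr /= -(adjointP d1 d2) -(adjointPr d0 d1).
Qed.

Lemma hodge_ge0 u : 0 <= d1 (D u) u.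
Proof. by rewrite hodge_dot addr_ge0 ?dot_ge0. Qed.

Lemma hodge_commM x : D (M x) = M (D x).
Proof.
rewrite !DE !comp_lfunE gf linear0 addr0 !linearD /=.
by rewrite fg linear0 addr0.
Qed.

Lemma hodge_commN x : D (N x) = N (D x).
Proof.
rewrite !DE !comp_lfunE fg linear0 add0r !linearD /=.
by rewrite gf linear0 add0r.
Qed.

Variables (a : K) (lam : seq K).
Hypotheses (a_ge0 : 0 <= a) (a_real : theta a = a).
Hypothesis lamP : spectrum D lam.

Local Notation W := (eigen_sum D lam (fun b => a < b)).
Local Notation W' := (eigen_sum D lam (predC (fun b => a < b))).
Local Notation p := (daddv_pi W W').

Let dimW : \dim W = count_gt a lam.
Proof. exact: (dim_eigen_sum hodge_sym lamP). Qed.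

Let W_gt x : x \in W -> x != 0 -> a * d1 x x < d1 (D x) x.
Proof. by apply: (eigen_sum_quotient_gt hodge_sym) => b. Qed.

Let W'_le x : x \in W' -> d1 (D x) x <= a * d1 x x.
Proof.
apply: (eigen_sum_quotient_le hodge_sym hodge_ge0) => b /= ab b0.
by rewrite real_leNgt ?ger0_real.
Qed.

Let MW x : x \in W -> M x \in W.
Proof. exact: eigen_sum_stable hodge_commM. Qed.

Let NW x : x \in W -> N x \in W.
Proof. exact: eigen_sum_stable hodge_commN. Qed.

(** The images of [fs] and [g] are orthogonal because [f \o g = 0], so the sum is direct. It lies in
    [W] since [M] and [N] commute with [D], and it fills [W] since [D], with eigenvalues above
    [a >= 0], is injective on [W]. *)
Lemma dim_split : (\dim (M @: W) + \dim (N @: W) = \dim W)%N.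
Proof.
apply/eqP; rewrite -dimv_disjoint_sum; last first.
  apply/eqP; rewrite -subv0; apply/subvP => x /memv_capP[].
  case/memv_imgP=> y yW -> /memv_imgP[z zW xE]; rewrite memv0; apply/eqP.
  apply: (dot_eq0 (d := d1)); rewrite {2}xE !comp_lfunE adjointPr fg.
  by rewrite linear0r.
rewrite eqn_leq; apply/andP; split; apply: dimvS.
  by rewrite subv_add; apply/andP; split; apply/subvP => x /memv_imgP[y yW ->];
    [exact: MW | exact: NW].
have DW : (D @: W = W)%VS.
  apply/eqP; rewrite eqEdim limg_dim_eq ?leqnn ?andbT.
    apply/subvP => x /memv_imgP[y yW ->].
    by rewrite add_lfunE memvD ?MW ?NW.
  apply/eqP; rewrite -subv0; apply/subvP => x /memv_capP[xW].
  rewrite memv_ker memv0 => /eqP Dx; apply: contraT => x0.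
  have := W_gt xW x0; rewrite Dx linear0l le_gtF //.
  by rewrite mulr_ge0 ?dot_ge0.
rewrite -{1}DW; apply/subvP => x /memv_imgP[y yW ->].
by rewrite add_lfunE memv_add ?memv_img.
Qed.

(** If [y] is the component of [x] in [W'], then [h x = h y], hence |h x|^2 <= <D y, y> <= a |y|^2
    <= a |x|^2, the last step by Pythagoras. It serves for [h = f] and for [h = gs]. *)
Lemma proj_ker_bound (V : vectType K) (d : {dot V for theta})
    (h : 'Hom(V1, V)) x :
  (forall y, d (h y) (h y) <= d1 (D y) y) -> h (p x) = 0 ->
  d (h x) (h x) <= a * d1 x x.
Proof.
move=> hD hpx; pose y := daddv_pi W' W x.
have xE : x = p x + y.
  rewrite daddv_pi_add ?(eigen_sum_capC hodge_sym) //.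
  by rewrite (eigen_sum_addC hodge_sym lamP) memvf.
have hx : h x = h y by rewrite xE linearD /= hpx add0r.
rewrite hx; apply: le_trans (hD y) (le_trans (W'_le (memv_pi _ _ _)) _).
apply: ler_wpM2l => //; rewrite [in leRHS]xE hnormDd /=.
  by rewrite lerDr dot_ge0.
apply: (eigen_sum_ortho hodge_sym _ (memv_pi _ _ _) (memv_pi _ _ _)).
by move=> b /= ->.
Qed.

(** The maps [M \o p] on [S1] and [N \o (p \o g)] on [S0] are injective, with values in [M @: W] and
    [N @: W]: a nonzero kernel vector would satisfy the bound of [proj_ker_bound], against
    expansion. *)
Lemma expands_count_ub S0 S1 :
  expands d0 d1 g a S0 -> expands d1 d2 f a S1 ->
  (\dim S0 + \dim S1 <= count_gt a lam)%N.
Proof.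
move=> gS0 fS1; rewrite -dimW -dim_split addnC; apply: leq_add.
  rewrite -(limg_dim_eq (f := (M \o p)%VF)).
    by rewrite limg_comp dimvS // limgS //; apply/subvP => x /memv_imgP[y _ ->];
      exact: memv_pi.
  apply/eqP; rewrite -subv0; apply/subvP => x /memv_capP[xS].
  rewrite memv_ker memv0 comp_lfunE => /eqP Mpx; apply: contraT => x0.
  have fpx : f (p x) = 0.
    apply: (dot_eq0 (d := d2)).
    by rewrite -(adjointPr d1 d2) -comp_lfunE Mpx linear0l.
  have := fS1 x xS x0; rewrite le_gtF //; apply: proj_ker_bound fpx => y.
  by rewrite hodge_dot lerDl dot_ge0.
rewrite -(limg_dim_eq (f := (N \o (p \o g))%VF)).
  rewrite limg_comp dimvS // limgS //; apply/subvP => x /memv_imgP[y _ ->].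
  by rewrite comp_lfunE memv_pi.
apply/eqP; rewrite -subv0; apply/subvP => z /memv_capP[zS].
rewrite memv_ker memv0 !comp_lfunE => /eqP Npz; apply: contraT => z0.
set w := g z.
have gpw : gs (p w) = 0.
  by apply: (dot_eq0 (d := d0)); rewrite -adjointP Npz linear0l.
have gw : d0 (gs w) (gs w) <= a * d1 w w.
  by apply: proj_ker_bound gpw => y; rewrite hodge_dot lerDr dot_ge0.
have := gS0 z zS z0; rewrite -/w => lt_zw.
have zw : d0 z (gs w) = d1 w w by rewrite -adjointP.
(* Expansion of [g] at [z] is transferred to expansion of [gs] at [w = g z], which contradicts
   [gw]. *)
have : a * d0 z (gs w) < d0 (gs w) (gs w).
  by apply: dot_square_gt; rewrite // zw // adjointPr.
by rewrite zw le_gtF.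
Qed.

(** On [M @: W] the map [gs] vanishes and on [N @: W] the map [f] does, so the form of [D] reduces
    to |f x|^2 or |gs x|^2. Applying [gs] to [N @: W] moves the second subspace into [V0], where [g]
    acts. *)
Lemma expands_count_lb :
  exists S0 S1, [/\ expands d0 d1 g a S0, expands d1 d2 f a S1 &
    (\dim S0 + \dim S1 = count_gt a lam)%N].
Proof.
exists (gs @: (N @: W))%VS, (M @: W)%VS; split.
- move=> z /memv_imgP[w wNW ->] z0.
  have wW : w \in W by case/memv_imgP: wNW => y yW ->; exact: NW.
  have w0 : w != 0 by apply: contraNneq z0 => ->; rewrite linear0.
  have fw : f w = 0 by case/memv_imgP: wNW => y yW ->; rewrite comp_lfunE fg.
  have := W_gt wW w0; rewrite hodge_dot fw linear0l add0r => lt_w.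
  have wgw : d1 w (g (gs w)) = d0 (gs w) (gs w) by rewrite -(adjointPr d0 d1).
  (* Here expansion of [gs] at [w] becomes expansion of [g] at [gs w]. *)
  rewrite -wgw; apply: dot_square_gt; rewrite ?wgw //.
  by rewrite (adjointP d0 d1).
- move=> x /memv_imgP[y yW ->] x0; have := W_gt (MW yW) x0.
  by rewrite hodge_dot !comp_lfunE gf linear0l addr0.
(* It remains that [gs] is injective on [N @: W]: this space lies in the image of [g], which is
   orthogonal to the kernel of [gs]. *)
rewrite -dimW -dim_split addnC; congr (_ + _)%N; apply: limg_dim_eq.
apply/eqP; rewrite -subv0; apply/subvP => x /memv_capP[/memv_imgP[y yW ->]].
rewrite memv_ker memv0 => /eqP gx; apply/eqP/(dot_eq0 (d := d1)).
by rewrite {1}comp_lfunE (adjointP d0 d1) gx linear0r.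
Qed.

End Hodge.

(** * Interlacing of two Hodge Laplacians *)

Section Compare.
Variables (K : numFieldType) (theta : involutive_rmorphism K).
Variables (V0 V1 V2 : vectType K) (d0 : {dot V0 for theta}).
Variables (d1 : {dot V1 for theta}) (d2 : {dot V2 for theta}).
Variables (f f1 f2 : 'Hom(V1, V2)) (g g1 g2 : 'Hom(V0, V1)).
Local Notation hodge f g :=
  ((adjoint d1 d2 f \o f) + (g \o adjoint d0 d1 g))%VF.

(** Expanding subspaces that attain the count for one pair of maps are carried to the other pair,
    cut down to the kernels of [f2] and [g2] in one direction and unchanged in the other. *)
Lemma hodge_interlaced (lam mu : seq K) :
  (forall a, 0 <= a -> theta a = a) ->
  (f \o g = 0)%VF -> (f1 \o g1 = 0)%VF ->
  (forall x, d2 (f x) (f x) = d2 (f1 x) (f1 x) + d2 (f2 x) (f2 x)) ->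
  (forall x, d1 (g x) (g x) = d1 (g1 x) (g1 x) + d1 (g2 x) (g2 x)) ->
  spectrum (hodge f g) lam -> spectrum (hodge f1 g1) mu ->
  interlaced (\dim (limg f2) + \dim (limg g2)) 0 lam mu.
Proof.
move=> real fg f1g1 ff gg lamP muP.
have [slam zlam _] := lamP; have [smu zmu _] := muP.
apply: interlaced_count => // [|||a a0|a a0].
- by rewrite zlam zmu.
- exact: (spectrum_ge0 (hodge_ge0 d0 d1 d2 f g) lamP).
- exact: (spectrum_ge0 (hodge_ge0 d0 d1 d2 f1 g1) muP).
- have [S0 [S1 [gS fS <-]]] := expands_count_lb fg a0 (real a a0) lamP.
  have [T0 gT dT0] := expands_restrict gg gS.
  have [T1 fT dT1] := expands_restrict ff fS.
  have := expands_count_ub f1g1 a0 (real a a0) muP gT fT.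
  by move: dT0 dT1; lia.
- have [S0 [S1 [gS fS <-]]] := expands_count_lb f1g1 a0 (real a a0) muP.
  apply: (expands_count_ub fg a0 (real a a0) lamP).
    exact: expands_mono gg gS.
  exact: expands_mono ff fS.
Qed.

End Compare.

(** * Extension by zero from the subcomplex *)

Section Padding.
Variables (K : numFieldType) (theta : involutive_rmorphism K).
Variables (P : cell_data) (F : sheaf_data theta P) (A : {set P}).
Local Notation FA := (pullback A F).

Definition cell_inclusion (k : int)
    (s : {s : subcomplex A | (cdim s)%:Z == k}) : {s : P | (cdim s)%:Z == k} :=
  exist (fun s : P => (cdim s)%:Z == k) (val (val s)) (valP s).

Lemma sum_subcomplex (V : nmodType) k
    (G : {s : P | (cdim s)%:Z == k} -> V) :
  (forall s, val s \notin A -> G s = 0) ->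
  \sum_s G s = \sum_s G (cell_inclusion (k := k) s).
Proof.
move=> G0; rewrite (bigID (fun s => val s \in A)) /= [X in _ + X]big1 // addr0.
have inj : injective (cell_inclusion (k := k)).
  by move=> s t /(congr1 val)/= st; do 2!apply: val_inj.
transitivity (\sum_(s in @cell_inclusion k @: predT) G s); last first.
  by rewrite big_imset //; exact: in2W.
apply: eq_bigl => s; apply/idP/imsetP => [sA|[t _ ->]];
  last exact: valP (val t).
exists (exist (fun s : subcomplex A => (cdim s)%:Z == k)
  (exist _ (val s) sA) (valP s)) => //.
exact: val_inj.
Qed.

Lemma cochain_restrictE k (x : cochain F k) s :
  cochain_restrict F A k x s = x (cell_inclusion s).
Proof. by rewrite lfunE ffunE. Qed.

Lemma cochain_extend_incl k (y : cochain FA k) s :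
  cochain_extend F A k y (cell_inclusion s) = y s.
Proof.
rewrite lfunE ffunE /extend_at /=.
case: pselect => [sA|nA]; last first.
  by exfalso; apply: nA; case: s => -[].
(* The two indices differ only in their proofs of membership and of degree. *)
case: s sA => [[s sA'] sk] /= sA; move: (valP _) => /= sk'.
by rewrite (bool_irrelevance sA sA') (bool_irrelevance sk' sk).
Qed.

Lemma cochain_extend0 k (y : cochain FA k) s :
  val s \notin A -> cochain_extend F A k y s = 0.
Proof.
by rewrite lfunE ffunE /extend_at => /negP sA; case: pselect.
Qed.

Lemma cochain_extendK k (y : cochain FA k) :
  cochain_restrict F A k (cochain_extend F A k y) = y.
Proof.
by apply/ffunP => s; rewrite cochain_restrictE cochain_extend_incl.
Qed.

(** Extension by zero is thus adjoint to restriction, which reduces adjoints of padded maps to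
    adjoints on the subcomplex. *)
Lemma cdot_extend k (y : cochain FA k) (x : cochain F k) :
  cdot F k (cochain_extend F A k y) x = cdot FA k y (cochain_restrict F A k x).
Proof.
rewrite /cdot /= /cochain_dot sum_subcomplex /= => [|s sA]; last first.
  by rewrite cochain_extend0 // linear0l.
apply: eq_bigr => s _.
by rewrite cochain_extend_incl cochain_restrictE.
Qed.

Definition padded_coboundary (j k : int) : 'Hom(cochain F j, cochain F k) :=
  (cochain_extend F A k \o coboundary FA j k
     \o cochain_restrict F A j)%VF.

Lemma adjoint_padded_coboundary j k :
  adjoint (cdot F j) (cdot F k) (padded_coboundary j k) =
  (cochain_extend F A j
     \o adjoint (cdot FA j) (cdot FA k) (coboundary FA j k)
     \o cochain_restrict F A k)%VF.
Proof.
apply: adjoint_unique => u v; rewrite !comp_lfunE cdot_extend.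
rewrite (adjointP (cdot FA j) (cdot FA k)).
by rewrite [RHS]dotC cdot_extend -dotC.
Qed.

(** Presents the padded operator as a Hodge Laplacian on the cochain spaces of [F], ready for
    [hodge_interlaced]; each inner restriction cancels the extension before it. *)
Lemma pad_laplacian k :
  pad (laplacian FA k) =
  ((adjoint (cdot F k) (cdot F (k + 1)) (padded_coboundary k (k + 1))
      \o padded_coboundary k (k + 1))
   + (padded_coboundary (k - 1) k
      \o adjoint (cdot F (k - 1)) (cdot F k) (padded_coboundary (k - 1) k)))%VF.
Proof.
rewrite !adjoint_padded_coboundary; apply/lfunP => x.
rewrite /pad /laplacian /padded_coboundary !(add_lfunE, comp_lfunE).
by rewrite !cochain_extendK linearD.
Qed.

End Padding.

(** * Splitting the coboundary along [C] *)

Section Split.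
Variables (K : numFieldType) (theta : involutive_rmorphism K).
Variables (P : cell_data) (F : sheaf_data theta P) (C : {set P}).
Hypotheses (inc_signed : signed_incidence P) (C_up : upward_closed C).

Local Notation delta := (coboundary F).
Local Notation deltaY := (padded_coboundary F (~: C)).
(** The type ascription moves this map to the cochain spaces of [F], convertible to those of
    [kill_outside C F] as the stalks agree. *)
Definition killed_coboundary (j k : int) : 'Hom(cochain F j, cochain F k) :=
  coboundary (kill_outside C F) j k.
Local Notation deltaG := killed_coboundary.

Lemma incidence_from_C (s t : P) : s \in C -> t \notin C -> incidence s t = 0.
Proof.
have [_ incE _] := inc_signed => sC; apply: contraNeq; rewrite incE.
by move=> /andP[st _]; exact: C_up st.
Qed.

Lemma padded_coboundary_in j k (x : cochain F j) t :
  val t \in C -> deltaY j k x t = 0.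
Proof. by move=> tC; rewrite !comp_lfunE cochain_extend0 // inE tC. Qed.

Lemma padded_coboundary_out j k (x : cochain F j) t :
  val t \notin C -> deltaY j k x t = delta j k x t.
Proof.
move=> tC; have tY : val t \in ~: C by rewrite inE.
pose t' : {s : subcomplex (~: C) | (cdim s)%:Z == k} :=
  exist (fun s : subcomplex (~: C) => (cdim s)%:Z == k)
    (exist _ (val t) tY) (valP t).
have -> : t = cell_inclusion t' by exact: val_inj.
rewrite !comp_lfunE cochain_extend_incl !coboundaryE.
rewrite [RHS](sum_subcomplex (A := ~: C)) => [|s].
  by apply: eq_bigr => s _; rewrite cochain_restrictE.
by rewrite inE negbK => sC; rewrite incidence_from_C // scale0r.
Qed.

Lemma killed_coboundary_in j k (x : cochain F j) t :
  val t \in C -> deltaG j k x t = delta j k x t.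
Proof.
move=> tC; rewrite [LHS](coboundaryE (F := kill_outside C F)) coboundaryE.
by apply: eq_bigr => s _; rewrite /= tC !andbF.
Qed.

Lemma killed_coboundary_out j k (x : cochain F j) t :
  val t \notin C -> deltaG j k x t = 0.
Proof.
move=> tC; rewrite [LHS](coboundaryE (F := kill_outside C F)) big1 // => s _.
have [sC|sC] := boolP (val s \in C); first by rewrite incidence_from_C ?scale0r.
have [->|] := eqVneq (incidence (val s) (val t)) 0; first by rewrite scale0r.
have [_ -> _] := inc_signed => /andP[_ st].
(* [kill_outside] keeps the map from a cell to itself, but the jump in dimension rules out that
   case. *)
have st' : val s != val t.
  by apply: contraTneq st => ->; rewrite eqn_leq ltnn andbF.
by rewrite /= st' sC tC zero_lfunE scaler0.
Qed.

Lemma coboundary_dot_split j k (x : cochain F j) :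
  cdot F k (delta j k x) (delta j k x) =
  cdot F k (deltaY j k x) (deltaY j k x)
  + cdot F k (deltaG j k x) (deltaG j k x).
Proof.
rewrite /cdot /= /cochain_dot -big_split; apply: eq_bigr => t _ /=.
have [tC|tC] := boolP (val t \in C).
  by rewrite padded_coboundary_in // killed_coboundary_in // linear0l add0r.
by rewrite padded_coboundary_out // killed_coboundary_out // linear0l addr0.
Qed.

(** Inherited from the full complex: at a cell outside [C] only values outside [C] contribute, and
    there [deltaY] agrees with [delta]. *)
Lemma padded_coboundary_comp0 i j k : j = i + 1 -> k = j + 1 ->
  transitive (@face P) -> is_sheaf F -> (deltaY j k \o deltaY i j = 0)%VF.
Proof.
move=> ji kj face_trans F_sheaf; apply/lfunP => x; apply/ffunP => t.
rewrite comp_lfunE zero_lfunE [RHS]ffunE.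
have [tC|tC] := boolP (val t \in C); first exact: padded_coboundary_in.
rewrite padded_coboundary_out //.
transitivity (delta j k (delta i j x) t); last first.
  by rewrite -comp_lfunE coboundary_comp0 // zero_lfunE ffunE.
rewrite !coboundaryE; apply: eq_bigr => s _.
have [sC|sC] := boolP (val s \in C).
  by rewrite incidence_from_C // !scale0r.
by rewrite padded_coboundary_out // coboundaryE.
Qed.

End Split.

(** * Codimension of cohomology and conclusion *)

(** By rank-nullity, [dim_cohomology] is the full dimension minus both ranks, truncated at 0; the
    truncation produces the minimum. *)
Lemma codim_cohomology (K : numFieldType) (theta : involutive_rmorphism K)
    (P : cell_data) (F : sheaf_data theta P) k :
  (\dim {:cochain F k} - dim_cohomology F k =
   minn (\dim {:cochain F k})
     (\dim (limg (coboundary F k (k + 1)))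
      + \dim (limg (coboundary F (k - 1) k))))%N.
Proof.
have := limg_ker_dim (coboundary F k (k + 1)) fullv; rewrite capfv.
rewrite /dim_cohomology; lia.
Qed.

Lemma face_poset_trans (R : realType) (X : regular_cell_complex R)
    (inc : cell X -> cell X -> int) : transitive (@face (face_poset inc)).
Proof.
move=> s r t /asboolP rs /asboolP st; apply/asboolP.
apply: subset_trans rs _; move/closureS: st.
by rewrite -((closure_id _).1 (@closed_closure _ _)).
Qed.

Lemma conjugation_real (R : realType) (kind : scalar_kind)
    (a : scalars R kind) : 0 <= a -> conjugation R kind a = a.
Proof. by case: kind a => //= a a0; apply/CrealP/ger0_real. Qed.

Theorem proposition5p8 (R : realType) (kind : scalar_kind)
    (X : regular_cell_complex R) (inc : cell X -> cell X -> int)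
    (inc_signed : signed_incidence (face_poset inc))
    (F : sheaf_data (conjugation R kind) (face_poset inc))
    (F_sheaf : is_sheaf F)
    (C : {set face_poset inc}) (C_up : upward_closed C)
    (k : int) (lam mu : seq (scalars R kind))
    (lam_spectrum : spectrum (laplacian F k) lam)
    (mu_spectrum : spectrum (pad (laplacian (pullback (~: C) F) k)) mu) :
  let G := kill_outside C F in
  let t := (\dim {:cochain F k} - dim_cohomology G k)%N in
  interlaced t 0 lam mu.
Proof.
move=> G t; have km : k = k - 1 + 1 by rewrite subrK.
have fg := coboundary_comp0 km (erefl (k + 1)) inc_signed
  (@face_poset_trans _ _ inc) F_sheaf.
have fg1 := padded_coboundary_comp0 inc_signed C_up km (erefl (k + 1))
  (@face_poset_trans _ _ inc) F_sheaf.
rewrite pad_laplacian in mu_spectrum.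
have [eqsz itl] := hodge_interlaced (@conjugation_real R kind) fg fg1
  (@coboundary_dot_split _ _ _ F C inc_signed C_up k (k + 1))
  (@coboundary_dot_split _ _ _ F C inc_signed C_up (k - 1) k)
  lam_spectrum mu_spectrum.
split=> // j jmu; have [itl1 itl2] := itl j jmu; split=> // tj.
have tE : t = minn (size mu) (\dim (limg (killed_coboundary F C k (k + 1)))
    + \dim (limg (killed_coboundary F C (k - 1) k)))%N.
  have [_ zlam _] := lam_spectrum; rewrite -eqsz zlam.
  exact: codim_cohomology.
(* As [t <= j < size mu], the minimum in [tE] is attained by the sum of ranks. *)
have <- : (\dim (limg (killed_coboundary F C k (k + 1)))
    + \dim (limg (killed_coboundary F C (k - 1) k)))%N = t.
  by move: tj jmu; rewrite tE; lia.
by apply: itl1; move: tj jmu; rewrite tE; lia.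
Qed.
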